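(* For any angle $\alpha\in(0,\pi/2)$ and any constant $q\in(0,1)$ there is a piecewise smooth planar curve such that its arc-length parameterization $g=g_{q,\alpha}:\mathbb{R}\to\mathbb{C}$ has the following properties: (a) $g([0,1])$ is a horizontal interval, and there exists $L_{q,\alpha}>0$ such that $g([1+L_{q,\alpha},+\infty))$ and $g((-\infty,-L_{q,\alpha}])$ are horizontal rays; (b) there exists $t_{q,\alpha}>1/2$ such that the arguments of $z_{+}=g(1/2+t_{q,\alpha})-g(1/2)$ and $z_{-}=g(1/2-t_{q,\alpha})-g(1/2)$ are equal to $-\alpha$ and $\pi+\alpha$ respectively; (c) $|g(t)-g(s)|/|t-s|>q$ for all $s\in[0,1]$ and all $t\in\mathbb{R}$ with $t\neq s$.
   Context: The plane is identified with $\mathbb{C}$ with the Euclidean norm $|\cdot|$; arc length is Euclidean arc length, and arguments of complex numbers are understood modulo $2\pi$. ''Horizontal'' means parallel to the real axis. *)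

(* Defs.v *)
From Stdlib Require Import Reals List.
From Coquelicot Require Import Coquelicot.
Open Scope R_scope.

Definition smooth (f : R -> C) : Prop :=
  forall (n : nat) (t : R),
    ex_derive_n (fun u => Re (f u)) n t /\ ex_derive_n (fun u => Im (f u)) n t.

(* [l] is a finite list of breakpoints; "smooth on the closed interval [a, b]"
   means that g agrees there with some smooth function on the whole line.
   Since adjacent pieces share their endpoint, g is in particular continuous. *)
Definition piecewise_smooth (g : R -> C) : Prop :=
  exists l : list R,
    forall a b : R, a <= b -> (forall x, In x l -> ~ (a < x < b)) ->
      exists f : R -> C, smooth f /\ forall t, a <= t <= b -> g t = f t.

(* [p 0 <= p 1 <= ... <= p (S n)] is the subdivision of [a, b]. *)
Definition inscribed_polygon_length (g : R -> C) (a b len : R) : Prop :=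
  exists (n : nat) (p : nat -> R),
    p 0%nat = a /\ p (S n) = b /\
    (forall i, (i <= n)%nat -> p i <= p (S i)) /\
    len = sum_n (fun i => Cmod (g (p (S i)) - g (p i))%C) n.

Definition is_arc_length (g : R -> C) (a b len : R) : Prop :=
  is_lub (inscribed_polygon_length g a b) len.

Definition arc_length_parameterized (g : R -> C) : Prop :=
  forall a b : R, a <= b -> is_arc_length g a b (b - a).

Definition image (g : R -> C) (D : R -> Prop) (z : C) : Prop :=
  exists t : R, D t /\ g t = z.

Definition horizontal_interval (S : C -> Prop) : Prop :=
  exists y a b : R, a < b /\ forall z : C, S z <-> Im z = y /\ a <= Re z <= b.

Definition horizontal_ray (S : C -> Prop) : Prop :=
  exists y a : R,
    (forall z : C, S z <-> Im z = y /\ a <= Re z) \/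
    (forall z : C, S z <-> Im z = y /\ Re z <= a).

(* [theta] is a representative modulo 2 PI of the argument of [z]. *)
Definition has_arg (z : C) (theta : R) : Prop :=
  z <> RtoC 0 /\ z = (RtoC (Cmod z) * (cos theta, sin theta))%C.

(* Main.v *)
(** A unit-speed ray may turn by any angle smaller than [1 - q]: provided the
    turn is made late enough, chords to the initial unit segment stay longer
    than [q] times the arc, because the history before the turn is negligible.
    Turning by many small angles, each made late enough, therefore reaches any
    direction.  We turn to direction [- alpha], make one small correction so as
    to cross the half-line of argument [- alpha], and turn back to direction 0.
    Reflecting this half curve in the vertical line [Re z = 1/2] gives [g]. *)
Require Import Defs.
From Stdlib Require Import Reals Lra Lia List Arith.
From Coquelicot Require Import Coquelicot.
Open Scope R_scope.

Definition dir (a : R) : C := (cos a, sin a).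

Lemma Cmod_dir (a : R) : Cmod (dir a) = 1.
Proof.
  unfold Cmod, dir; simpl fst; simpl snd.
  rewrite <- sqrt_1; f_equal.
  generalize (sin2_cos2 a); unfold Rsqr; lra.
Qed.

Lemma Rsqr_sin_le (x : R) : Rsqr (sin x) <= Rsqr x.
Proof.
  apply Rsqr_le_abs_1.
  assert (pos : forall y, 0 <= y -> Rabs (sin y) <= y).
  { intros y [Hy | <-].
    - apply Rabs_le; split; [| now apply Rlt_le, sin_lt_x].
      destruct (Rle_dec 1 y) as [H1 | H1].
      + generalize (SIN_bound y); lra.
      + assert (0 <= sin y) by (apply sin_ge_0; generalize PI2_1; lra); lra.
    - rewrite sin_0, Rabs_R0; lra. }
  unfold Rabs at 2; destruct (Rcase_abs x).
  - rewrite <- (Rabs_Ropp (sin x)), <- sin_neg; apply pos; lra.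
  - apply pos; lra.
Qed.

Lemma dir_dist (a b : R) : Cmod (dir a - dir b)%C <= Rabs (a - b).
Proof.
  rewrite <- sqrt_Rsqr_abs; apply sqrt_le_1_alt; simpl.
  generalize (Rsqr_sin_le ((a - b) / 2)) (cos_2a_sin ((a - b) / 2)) (cos_minus a b)
    (sin2_cos2 a) (sin2_cos2 b).
  replace (2 * ((a - b) / 2)) with (a - b) by field.
  unfold Rsqr; intros; nra.
Qed.

(** * Unit-speed polygonal curves *)

Definition breakless (l : list R) (a b : R) : Prop :=
  forall x, In x l -> ~ (a < x < b).

Definition unit_affine_on (g : R -> C) (a b : R) : Prop :=
  exists p v : C, Cmod v = 1 /\ forall t, a <= t <= b -> g t = (p + t * v)%C.

Definition unit_polygonal (g : R -> C) : Prop :=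
  exists l : list R, forall a b : R, a <= b -> breakless l a b -> unit_affine_on g a b.

Lemma subdivision_ind (P : R -> R -> Prop) :
  (forall a b c, a <= b <= c -> P a b -> P b c -> P a c) ->
  forall l a b, a <= b ->
  (forall c d, a <= c -> c <= d -> d <= b -> breakless l c d -> P c d) ->
  P a b.
Proof.
  intros Padd; induction l as [| x l IH]; intros a b Hab H.
  - apply H; try lra; intros y [].
  - assert (cut : forall c d, a <= c -> c <= d -> d <= b -> ~ (c < x < d) -> P c d).
    { intros c d Hac Hcd Hdb Hx; apply IH; [exact Hcd |].
      intros c' d' H1 H2 H3 Hl; apply H; try lra.
      intros y [<- | Hy]; [lra | now apply Hl]. }
    destruct (Rlt_dec a x) as [Hax | Hax]; [destruct (Rlt_dec x b) as [Hxb | Hxb] |].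
    + apply (Padd a x b); [lra | apply cut; lra | apply cut; lra].
    + apply cut; lra.
    + apply cut; lra.
Qed.

Lemma unit_affine_dist (g : R -> C) (a b : R) :
  a <= b -> unit_affine_on g a b -> Cmod (g b - g a)%C = b - a.
Proof.
  intros Hab (p & v & Hv & Hg).
  rewrite !Hg by lra.
  replace (p + b * v - (p + a * v))%C with (RtoC (b - a) * v)%C
    by (rewrite RtoC_minus; ring).
  rewrite Cmod_mult, Cmod_R, Hv, Rabs_pos_eq by lra; ring.
Qed.

Lemma Cmod_sub_triangle (x y z : C) : Cmod (z - x)%C <= Cmod (y - x)%C + Cmod (z - y)%C.
Proof.
  replace (z - x)%C with ((y - x) + (z - y))%C by ring; apply Cmod_triangle.
Qed.

Lemma unit_polygonal_lipschitz (g : R -> C) (a b : R) :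
  unit_polygonal g -> a <= b -> Cmod (g b - g a)%C <= b - a.
Proof.
  intros [l Hl] Hab.
  apply (subdivision_ind (fun a b => Cmod (g b - g a)%C <= b - a)) with (l := l);
    [| exact Hab |].
  - intros x y z _ H1 H2.
    generalize (Cmod_sub_triangle (g x) (g y) (g z)); lra.
  - intros c d _ Hcd _ Hb.
    rewrite unit_affine_dist; auto; lra.
Qed.

Lemma inscribed_polygon_length_concat (g : R -> C) (a b c l1 l2 : R) :
  inscribed_polygon_length g a b l1 -> inscribed_polygon_length g b c l2 ->
  inscribed_polygon_length g a c (l1 + l2).
Proof.
  intros (n & p & Hp0 & Hpn & Hpm & ->) (m & r & Hr0 & Hrm & Hrn & ->).
  set (s := fun i => if le_dec i (S n) then p i else r (i - S n)%nat).
  assert (s_lo : forall i, (i <= S n)%nat -> s i = p i).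
  { intros i Hi; unfold s; destruct (le_dec i (S n)); [reflexivity | lia]. }
  assert (s_hi : forall i, s (S n + i)%nat = r i).
  { intros i; unfold s; destruct (le_dec (S n + i) (S n)).
    - replace i with 0%nat by lia; rewrite Nat.add_0_r; congruence.
    - f_equal; lia. }
  exists (S n + m)%nat, s; repeat split.
  - rewrite s_lo by lia; exact Hp0.
  - replace (S (S n + m)) with (S n + S m)%nat by lia.
    rewrite s_hi; exact Hrm.
  - intros i Hi; destruct (le_dec i n) as [Hin | Hin].
    + rewrite !s_lo by lia; now apply Hpm.
    + replace i with (S n + (i - S n))%nat by lia.
      replace (S (S n + (i - S n))) with (S n + S (i - S n))%nat by lia.
      rewrite !s_hi; apply Hrn; lia.
  - assert (E : forall k, (k <= m)%nat ->
      sum_n (fun i => Cmod (g (s (S i)) - g (s i))%C) (S n + k) =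
      sum_n (fun i => Cmod (g (p (S i)) - g (p i))%C) n +
      sum_n (fun i => Cmod (g (r (S i)) - g (r i))%C) k).
    { induction k as [| k IHk]; intros Hk.
      - rewrite Nat.add_0_r, sum_Sn, sum_O.
        unfold plus; simpl; f_equal.
        + apply sum_n_ext_loc; intros i Hi; rewrite !s_lo by lia; reflexivity.
        + replace (S (S n)) with (S n + 1)%nat by lia.
          rewrite s_hi; do 3 f_equal.
          replace (S n) with (S n + 0)%nat by lia; now rewrite s_hi.
      - rewrite Nat.add_succ_r, !sum_Sn, IHk by lia.
        replace (S (S (S n + k))) with (S n + S (S k))%nat by lia.
        replace (S (S n + k)) with (S n + S k)%nat by lia.
        rewrite !s_hi; unfold plus; simpl; ring. }
    symmetry; apply E; lia.
Qed.

Lemma unit_polygonal_arc_length (g : R -> C) :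
  unit_polygonal g -> arc_length_parameterized g.
Proof.
  intros Hg a b Hab; split.
  - intros len (n & p & Ha & Hb & Hm & ->).
    rewrite <- Ha, <- Hb; clear a b Hab Ha Hb.
    induction n as [| n IHn].
    + rewrite sum_O; apply unit_polygonal_lipschitz; auto.
    + rewrite sum_Sn; unfold plus; simpl.
      assert (H1 := IHn (fun i Hi => Hm i (le_S _ _ Hi))).
      assert (H2 := unit_polygonal_lipschitz g _ _ Hg (Hm (S n) (le_n _))).
      lra.
  - intros u Hu; apply Hu; clear u Hu.
    destruct Hg as [l Hl].
    apply (subdivision_ind (fun a b => inscribed_polygon_length g a b (b - a)))
      with (l := l); [| exact Hab |].
    + intros x y z _ H1 H2.
      replace (z - x) with ((y - x) + (z - y)) by ring.
      now apply inscribed_polygon_length_concat with y.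
    + intros c d _ Hcd _ Hbl.
      exists 0%nat, (fun i => match i with O => c | _ => d end).
      repeat split; [intros [| i] _; lra |].
      rewrite sum_O; symmetry; apply unit_affine_dist; auto.
Qed.

Lemma ex_derive_n_affine (a b : R) (n : nat) (t : R) :
  ex_derive_n (fun u => a + u * b) n t.
Proof.
  apply ex_derive_n_plus; apply filter_forall; intros u k _.
  - apply ex_derive_n_const.
  - apply ex_derive_n_scal_r, (ex_derive_n_ext (fun u => u ^ 1)); [intros; ring |].
    apply ex_derive_n_pow.
Qed.

Lemma unit_polygonal_piecewise_smooth (g : R -> C) :
  unit_polygonal g -> piecewise_smooth g.
Proof.
  intros [l Hl]; exists l; intros a b Hab Hb.
  destruct (Hl a b Hab Hb) as (p & v & _ & Hg).
  exists (fun t => p + t * v)%C; split; [| exact Hg].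
  intros n t; split.
  - apply (ex_derive_n_ext (fun u => Re p + u * Re v)).
    + intros u; unfold Re; simpl; ring.
    + apply ex_derive_n_affine.
  - apply (ex_derive_n_ext (fun u => Im p + u * Im v)).
    + intros u; unfold Im; simpl; ring.
    + apply ex_derive_n_affine.
Qed.

Lemma unit_polygonal_line : unit_polygonal RtoC.
Proof.
  exists nil; intros a b _ _; exists (RtoC 0), (RtoC 1); split.
  - rewrite Cmod_R; apply Rabs_R1.
  - intros t _; ring.
Qed.

Definition bend (h : R -> C) (T a : R) (t : R) : C :=
  if Rle_dec t T then h t else (h T + (t - T)%R * dir a)%C.

Lemma bend_before (h : R -> C) (T a t : R) : t <= T -> bend h T a t = h t.
Proof. intros Ht; unfold bend; destruct (Rle_dec t T); [reflexivity | lra]. Qed.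

Lemma bend_after (h : R -> C) (T a t : R) :
  T <= t -> bend h T a t = (h T + (t - T)%R * dir a)%C.
Proof.
  intros Ht; unfold bend; destruct (Rle_dec t T); [| reflexivity].
  replace t with T by lra; rewrite Rminus_diag; ring.
Qed.

Lemma unit_polygonal_bend (h : R -> C) (T a : R) :
  unit_polygonal h -> unit_polygonal (bend h T a).
Proof.
  intros [l Hl]; exists (T :: l); intros c d Hcd Hb.
  destruct (Rle_dec d T) as [Hd | Hd].
  - destruct (Hl c d Hcd) as (p & v & Hv & Hg).
    { intros x Hx; apply Hb; now right. }
    exists p, v; split; [exact Hv |].
    intros t Ht; rewrite bend_before by lra; now apply Hg.
  - assert (Hc : T <= c) by (generalize (Hb T (or_introl eq_refl)); lra).
    exists (h T - T * dir a)%C, (dir a); split; [apply Cmod_dir |].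
    intros t Ht; rewrite bend_after by lra; rewrite RtoC_minus; ring.
Qed.

(** * Half curves *)

Record half_curve (q : R) (h : R -> C) (a : R) : Prop := {
  half_curve_polygonal : unit_polygonal h;
  half_curve_start : forall s, s <= 1 / 2 -> h s = RtoC s;
  half_curve_chord : forall s t, - (1 / 2) <= s <= 1 / 2 -> t <> s ->
    q * Rabs (t - s) < Cmod (h t - h s)%C;
  half_curve_ray : exists (p : C) (T : R), forall t, T <= t -> h t = (p + t * dir a)%C
}.

Lemma half_curve_line (q : R) : q < 1 -> half_curve q RtoC 0.
Proof.
  intros Hq; split.
  - apply unit_polygonal_line.
  - reflexivity.
  - intros s t _ Hts; rewrite <- RtoC_minus, Cmod_R.
    assert (0 < Rabs (t - s)) by (apply Rabs_pos_lt; lra); nra.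
  - exists (RtoC 0), 0; intros t _.
    unfold dir; rewrite cos_0, sin_0; change (1, 0) with (RtoC 1); ring.
Qed.

Lemma half_curve_bend (q : R) (h : R -> C) (a b : R) :
  0 < q -> Rabs (b - a) < 1 - q -> half_curve q h a ->
  exists T0, forall T, T0 <= T -> half_curve q (bend h T b) b.
Proof.
  intros Hq Hab [Hpoly Hstart Hchord (p & T1 & Hray)].
  set (c := 1 - q - Rabs (b - a)).
  exists (Rmax T1 (Rmax 1 ((Cmod p + 1) / c))); intros T HT.
  assert (HT1 : T1 <= T) by (eapply Rle_trans; [apply Rmax_l | exact HT]).
  assert (HT' : Rmax 1 ((Cmod p + 1) / c) <= T)
    by (eapply Rle_trans; [apply Rmax_r | exact HT]).
  assert (H1 : 1 <= T) by (eapply Rle_trans; [apply Rmax_l | exact HT']).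
  assert (Hc : 0 < c) by (unfold c; lra).
  assert (Hp : Cmod p + 1 <= T * c).
  { apply Rle_div_l; [exact Hc |]; eapply Rle_trans; [apply Rmax_r | exact HT']. }
  split.
  - now apply unit_polygonal_bend.
  - intros s Hs; rewrite bend_before by lra; now apply Hstart.
  - intros s t Hs Hts.
    destruct (Rle_dec t T) as [Ht | Ht].
    + rewrite !bend_before by lra; now apply Hchord.
    + rewrite (bend_before h T b s), bend_after, (Hstart s), Hray by lra.
      rewrite (Rabs_pos_eq (t - s)) by lra.
      (* The chord is [t dir a] up to the error [e]. *)
      set (e := (p - s + (t - T)%R * (dir b - dir a))%C).
      replace (p + T * dir a + (t - T)%R * dir b - s)%C with (t * dir a + e)%C
        by (unfold e; rewrite !RtoC_minus; ring).
      assert (He : Cmod e <= Cmod p + 1 / 2 + (t - T) * Rabs (b - a)).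
      { unfold e; eapply Rle_trans; [apply Cmod_triangle |].
        apply Rplus_le_compat.
        - eapply Rle_trans; [apply Cmod_triangle |].
          rewrite Cmod_opp, Cmod_R; apply Rplus_le_compat_l.
          apply Rabs_le; lra.
        - rewrite Cmod_mult, Cmod_R, Rabs_pos_eq by lra.
          apply Rmult_le_compat_l; [lra | apply dir_dist]. }
      assert (Hlow : t <= Cmod (t * dir a + e) + Cmod e).
      { replace t with (Cmod (t * dir a)) at 1
          by (rewrite Cmod_mult, Cmod_dir, Cmod_R, Rabs_pos_eq by lra; ring).
        replace (t * dir a)%C with ((t * dir a + e) + - e)%C at 1 by ring.
        eapply Rle_trans; [apply Cmod_triangle |]; rewrite Cmod_opp; lra. }
      assert (0 <= T * Rabs (b - a)) by (apply Rmult_le_pos; [lra | apply Rabs_pos]).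
      assert (T * c <= t * c) by (apply Rmult_le_compat_r; lra).
      assert (0 <= q * (s + 1 / 2)) by (apply Rmult_le_pos; lra).
      generalize (Rabs_pos (b - a)); unfold c in *; nra.
  - exists (h T - T * dir b)%C, T; intros t Ht.
    rewrite bend_after by exact Ht; rewrite RtoC_minus; ring.
Qed.

Lemma half_curve_turn (q : R) (h : R -> C) (a b A : R) :
  0 < q < 1 -> half_curve q h a ->
  exists h', half_curve q h' b /\ forall t, t <= A -> h' t = h t.
Proof.
  intros Hq Hh.
  destruct (archimed_cor1 ((1 - q) / (Rabs (b - a) + 1))) as (N & HN & HN0).
  { generalize (Rabs_pos (b - a)); intros; apply Rdiv_lt_0_compat; lra. }
  apply lt_INR in HN0; simpl in HN0.
  set (d := (b - a) / INR N).
  assert (Hd : Rabs d < 1 - q).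
  { generalize (Rabs_pos (b - a)); intros.
    unfold d, Rdiv; rewrite Rabs_mult, Rabs_inv, (Rabs_pos_eq (INR N)) by lra.
    apply Rlt_div_r in HN; [| lra].
    assert (0 < / INR N) by (apply Rinv_0_lt_compat; lra); nra. }
  assert (steps : forall n, exists h', half_curve q h' (a + INR n * d) /\
                                       forall t, t <= A -> h' t = h t).
  { induction n as [| n (h1 & Hh1 & Hagree)].
    - exists h; simpl; rewrite Rmult_0_l, Rplus_0_r; auto.
    - destruct (half_curve_bend q h1 (a + INR n * d) (a + INR (S n) * d) (proj1 Hq)) with (2 := Hh1)
        as [T0 HT0].
      { rewrite S_INR.
        replace (a + (INR n + 1) * d - (a + INR n * d)) with d by ring; exact Hd. }
      exists (bend h1 (Rmax T0 A) (a + INR (S n) * d)); split.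
      + apply HT0, Rmax_l.
      + intros t Ht; rewrite bend_before; [now apply Hagree |].
        eapply Rle_trans; [exact Ht | apply Rmax_r]. }
  destruct (steps N) as (h' & Hh' & Hagree).
  exists h'; split; [| exact Hagree].
  replace b with (a + INR N * d); [exact Hh' | unfold d; field; lra].
Qed.

Lemma dir_plus (a b : R) : dir (a + b) = (dir a * dir b)%C.
Proof.
  unfold dir, Cmult; simpl; rewrite cos_plus, sin_plus; f_equal; ring.
Qed.

Lemma half_curve_cross (q : R) (h : R -> C) (a : R) :
  0 < q < 1 -> half_curve q h a ->
  exists h' b t0 r, half_curve q h' b /\ 1 / 2 < t0 /\ 0 < r /\ h' t0 = (r * dir a)%C.
Proof.
  intros Hq Hh.
  destruct (half_curve_ray _ _ _ Hh) as (p & T1 & Hray).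
  destruct (p * dir (- a))%C as [w1 w2] eqn:Hw.
  assert (Hp : p = ((w1, w2) * dir a)%C).
  { rewrite <- Hw, <- Cmult_assoc, <- dir_plus, Rplus_opp_l.
    unfold dir; rewrite cos_0, sin_0; change (1, 0) with (RtoC 1); ring. }
  (* In the frame [dir a] the ray runs parallel to the target half-line at
     signed height [w2]; [eta] is the small turn towards it, and [k] the time
     needed to reach it. *)
  assert (exists eta k, Rabs eta < 1 - q /\ 0 < cos eta /\ 0 <= k /\ w2 = - (k * sin eta))
    as (eta & k & Heta & Hcos & Hk & Hw2).
  { set (x := (1 - q) / 2).
    assert (Hs : 0 < sin x) by (apply sin_gt_0; unfold x; generalize PI2_1; lra).
    assert (Hc : 0 < cos x) by (apply cos_gt_0; unfold x; generalize PI2_1; lra).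
    destruct (Rle_dec 0 w2) as [H0 | H0].
    - exists (- x), (w2 / sin x); rewrite Rabs_Ropp, cos_neg, sin_neg.
      repeat split; [rewrite Rabs_pos_eq; unfold x; lra | exact Hc | | field; lra].
      apply Rmult_le_pos; [exact H0 | now apply Rlt_le, Rinv_0_lt_compat].
    - exists x, (- w2 / sin x).
      repeat split; [rewrite Rabs_pos_eq; unfold x; lra | exact Hc | | field; lra].
      apply Rmult_le_pos; [lra | now apply Rlt_le, Rinv_0_lt_compat]. }
  destruct (half_curve_bend q h a (a + eta) (proj1 Hq)) with (2 := Hh) as [T0 HT0].
  { replace (a + eta - a) with eta by ring; exact Heta. }
  set (T := Rmax T0 (Rmax T1 (Rmax 1 (1 - w1)))).
  assert (T0 <= T) by apply Rmax_l.
  assert (Rmax T1 (Rmax 1 (1 - w1)) <= T) by apply Rmax_r.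
  assert (T1 <= Rmax T1 (Rmax 1 (1 - w1))) by apply Rmax_l.
  assert (Rmax 1 (1 - w1) <= Rmax T1 (Rmax 1 (1 - w1))) by apply Rmax_r.
  assert (1 <= Rmax 1 (1 - w1)) by apply Rmax_l.
  assert (1 - w1 <= Rmax 1 (1 - w1)) by apply Rmax_r.
  exists (bend h T (a + eta)), (a + eta), (T + k), (w1 + T + k * cos eta).
  assert (0 <= k * cos eta) by (apply Rmult_le_pos; lra).
  split; [now apply HT0 | split; [lra | split; [lra |]]].
  rewrite bend_after, Hray, Hp, dir_plus by lra.
  replace (T + k - T) with k by ring.
  rewrite Hw2; unfold dir, RtoC, Cmult, Cplus; simpl; f_equal; ring.
Qed.

(** * Reflection *)

Definition reflect_glue (h : R -> C) (t : R) : C :=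
  if Rle_dec (1 / 2) t then (RtoC (1 / 2) + h (t - 1 / 2)%R)%C
  else (RtoC (1 / 2) - Cconj (h (1 / 2 - t)%R))%C.

Lemma reflect_glue_right (h : R -> C) (t : R) :
  1 / 2 <= t -> reflect_glue h t = (RtoC (1 / 2) + h (t - 1 / 2)%R)%C.
Proof.
  intros Ht; unfold reflect_glue; destruct (Rle_dec (1 / 2) t); [reflexivity | lra].
Qed.

Lemma reflect_glue_left (h : R -> C) (t : R) :
  h 0 = RtoC 0 -> t <= 1 / 2 ->
  reflect_glue h t = (RtoC (1 / 2) - Cconj (h (1 / 2 - t)%R))%C.
Proof.
  intros H0 Ht; unfold reflect_glue; destruct (Rle_dec (1 / 2) t); [| reflexivity].
  replace t with (1 / 2) by lra; rewrite Rminus_diag, H0.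
  unfold Cconj, Cminus, Cplus, Copp, RtoC; simpl; f_equal; ring.
Qed.

Lemma unit_polygonal_reflect_glue (h : R -> C) :
  h 0 = RtoC 0 -> unit_polygonal h -> unit_polygonal (reflect_glue h).
Proof.
  intros H0 [l Hl].
  exists (1 / 2 :: map (fun x => x + 1 / 2) l ++ map (fun x => 1 / 2 - x) l).
  intros a b Hab Hb.
  destruct (Rle_dec (1 / 2) a) as [Ha | Ha].
  - destruct (Hl (a - 1 / 2) (b - 1 / 2)) as (p & v & Hv & Hg); [lra | |].
    { intros x Hx Hin; apply (Hb (x + 1 / 2)); [| lra].
      right; apply in_or_app; left; now apply (in_map (fun x => x + 1 / 2)). }
    exists (RtoC (1 / 2) + p - RtoC (1 / 2) * v)%C, v; split; [exact Hv |].
    intros t Ht; rewrite reflect_glue_right, Hg, RtoC_minus by lra; ring.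
  - assert (b <= 1 / 2) by (generalize (Hb (1 / 2) (or_introl eq_refl)); lra).
    destruct (Hl (1 / 2 - b) (1 / 2 - a)) as (p & v & Hv & Hg); [lra | |].
    { intros x Hx Hin; apply (Hb (1 / 2 - x)); [| lra].
      right; apply in_or_app; right; now apply (in_map (fun x => 1 / 2 - x)). }
    exists (RtoC (1 / 2) - Cconj p - RtoC (1 / 2) * Cconj v)%C, (Cconj v).
    split; [now rewrite Cmod_conj |].
    intros t Ht; rewrite reflect_glue_left, Hg by (assumption || lra).
    unfold Cconj, Cminus, Cplus, Cmult, Copp, RtoC; simpl; f_equal; ring.
Qed.

Lemma reflect_glue_middle (h : R -> C) (s : R) :
  (forall u, u <= 1 / 2 -> h u = RtoC u) -> 0 <= s <= 1 -> reflect_glue h s = RtoC s.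
Proof.
  intros Hstart Hs; destruct (Rle_dec (1 / 2) s).
  - rewrite reflect_glue_right, Hstart, RtoC_minus by lra; ring.
  - rewrite reflect_glue_left, Hstart by (lra || (apply Hstart; lra)).
    unfold Cconj, Cminus, Cplus, Copp, RtoC; simpl; f_equal; ring.
Qed.

Lemma reflect_glue_chord (q : R) (h : R -> C) (a s t : R) :
  half_curve q h a -> 0 <= s <= 1 -> t <> s ->
  q * Rabs (t - s) < Cmod (reflect_glue h t - reflect_glue h s)%C.
Proof.
  intros Hh Hs Hts.
  assert (Hstart := half_curve_start _ _ _ Hh).
  assert (H0 : h 0 = RtoC 0) by (apply Hstart; lra).
  rewrite (reflect_glue_middle h s) by assumption.
  destruct (Rle_dec (1 / 2) t) as [Ht | Ht].
  - rewrite reflect_glue_right by exact Ht.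
    assert (H := half_curve_chord _ _ _ Hh (s - 1 / 2) (t - 1 / 2)).
    rewrite (Hstart (s - 1 / 2)) in H by lra.
    replace (t - 1 / 2 - (s - 1 / 2)) with (t - s) in H by ring.
    replace (RtoC (1 / 2) + h (t - 1 / 2)%R - s)%C
      with (h (t - 1 / 2)%R - (s - 1 / 2)%R)%C by (rewrite RtoC_minus; ring).
    apply H; lra.
  - rewrite reflect_glue_left by (assumption || lra).
    assert (H := half_curve_chord _ _ _ Hh (1 / 2 - s) (1 / 2 - t)).
    rewrite (Hstart (1 / 2 - s)) in H by lra.
    replace (1 / 2 - t - (1 / 2 - s)) with (- (t - s)) in H by ring.
    rewrite Rabs_Ropp in H.
    replace (RtoC (1 / 2) - Cconj (h (1 / 2 - t)%R) - s)%C
      with (- Cconj (h (1 / 2 - t)%R - (1 / 2 - s)%R))%C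
      by (unfold Cconj, Cminus, Cplus, Copp, RtoC; simpl; f_equal; ring).
    rewrite Cmod_opp, Cmod_conj; apply H; lra.
Qed.

Lemma has_arg_polar (r theta : R) :
  0 < r -> has_arg (r * dir theta)%C theta.
Proof.
  intros Hr.
  assert (Hmod : Cmod (r * dir theta)%C = r)
    by (rewrite Cmod_mult, Cmod_dir, Cmod_R, Rabs_pos_eq by lra; ring).
  split.
  - intros E; rewrite E, Cmod_0 in Hmod; lra.
  - rewrite Hmod; reflexivity.
Qed.

Theorem lemma4p11 :
  forall alpha q : R, 0 < alpha < PI / 2 -> 0 < q < 1 ->
  exists g : R -> C,
    piecewise_smooth g /\
    arc_length_parameterized g /\
    (* (a) *)
    (horizontal_interval (image g (fun t => 0 <= t <= 1)) /\
     exists L : R, 0 < L /\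
       horizontal_ray (image g (fun t => 1 + L <= t)) /\
       horizontal_ray (image g (fun t => t <= - L))) /\
    (* (b) *)
    (exists t0 : R, 1 / 2 < t0 /\
       has_arg (g (1 / 2 + t0)%R - g (1 / 2)%R)%C (- alpha) /\
       has_arg (g (1 / 2 - t0)%R - g (1 / 2)%R)%C (PI + alpha)) /\
    (* (c) *)
    (forall s t : R, 0 <= s <= 1 -> t <> s ->
       Cmod (g t - g s)%C / Rabs (t - s) > q).
Proof.
  intros alpha q _ Hq.
  destruct (half_curve_turn q RtoC 0 (- alpha) 0 Hq (half_curve_line q (proj2 Hq)))
    as (h1 & Hh1 & _).
  destruct (half_curve_cross q h1 _ Hq Hh1) as (h2 & b & t0 & r & Hh2 & Ht0 & Hr & Hcross).
  destruct (half_curve_turn q h2 b 0 t0 Hq Hh2) as (h & Hh & Hagree).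
  rewrite <- Hagree in Hcross by lra.
  clear h1 Hh1 h2 Hh2 Hagree b.
  assert (Hpoly := half_curve_polygonal _ _ _ Hh).
  assert (Hstart := half_curve_start _ _ _ Hh).
  assert (H0 : h 0 = RtoC 0) by (apply Hstart; lra).
  assert (Hg := unit_polygonal_reflect_glue h H0 Hpoly).
  assert (Hhalf : reflect_glue h (1 / 2) = RtoC (1 / 2))
    by (rewrite reflect_glue_right, Rminus_diag, H0 by lra; ring).
  exists (reflect_glue h); split; [| split; [| split; [| split]]].
  - now apply unit_polygonal_piecewise_smooth.
  - now apply unit_polygonal_arc_length.
  - assert (Hmid := fun s => reflect_glue_middle h s Hstart).
    split.
    + exists 0, 0, 1; split; [lra |]; intros [x y]; simpl; split.
      * intros (t & Ht & E); rewrite Hmid in E by exact Ht; inversion E; lra.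
      * intros [-> Hx]; exists x; split; [exact Hx | now apply Hmid].
    + destruct (half_curve_ray _ _ _ Hh) as ([p1 p2] & T & Hray).
      assert (Hray' : forall t, T <= t -> h t = (p1 + t, p2)).
      { intros t Ht; rewrite Hray by exact Ht.
        unfold dir; rewrite cos_0, sin_0.
        unfold Cplus, Cmult, RtoC; simpl; f_equal; ring. }
      set (L := Rmax 1 T).
      assert (1 <= L) by apply Rmax_l; assert (T <= L) by apply Rmax_r.
      exists L; split; [lra |]; split.
      * exists p2, (p1 + 1 + L); left; intros [x y]; simpl; split.
        -- intros (t & Ht & E); rewrite reflect_glue_right, Hray' in E by lra.
           inversion E; lra.
        -- intros [-> Hx]; exists (x - p1); split; [lra |].
           rewrite reflect_glue_right, Hray' by lra.
           unfold Cplus, RtoC; simpl; f_equal; lra.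
      * exists p2, (- p1 - L); right; intros [x y]; simpl; split.
        -- intros (t & Ht & E); rewrite reflect_glue_left, Hray' in E by (assumption || lra).
           inversion E; lra.
        -- intros [-> Hx]; exists (x + p1); split; [lra |].
           rewrite reflect_glue_left, Hray' by (assumption || lra).
           unfold Cconj, Cminus, Cplus, Copp, RtoC; simpl; f_equal; lra.
  - exists t0; split; [exact Ht0 |]; rewrite Hhalf; split.
    + rewrite reflect_glue_right by lra.
      replace (1 / 2 + t0 - 1 / 2) with t0 by ring.
      replace (RtoC (1 / 2) + h t0 - RtoC (1 / 2))%C with (h t0) by ring.
      rewrite Hcross; now apply has_arg_polar.
    + rewrite reflect_glue_left by (assumption || lra).
      replace (1 / 2 - (1 / 2 - t0)) with t0 by ring.
      replace (RtoC (1 / 2) - Cconj (h t0) - RtoC (1 / 2))%C with (r * dir (PI + alpha))%C;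
        [now apply has_arg_polar |].
      rewrite Hcross; unfold dir.
      rewrite (Rplus_comm PI), neg_cos, neg_sin, cos_neg, sin_neg.
      unfold Cconj, Cminus, Cplus, Cmult, Copp, RtoC; simpl; f_equal; ring.
  - intros s t Hs Hts; apply Rlt_gt, Rlt_div_r; [apply Rabs_pos_lt; lra |].
    now apply reflect_glue_chord with 0.
Qed.
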